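(* Let $F$ be a graph with at least one edge and without isolated vertices, with $v$ vertices, $\ell$ edges and minimum degree $\delta$, and suppose that $F$ is a (not necessarily disjoint) union of cliques each of size at least $\delta+1$, i.e. every edge of $F$ lies in a complete subgraph of $F$ on at least $\delta+1$ vertices. Then $$\mathrm{wsat}(n,F)=(\delta-1)n+O(1)\qquad(n\to\infty),$$ where the implied constant may depend on $F$. Moreover, if in addition $\mathrm{wsat}(v,F)=\ell-1$, then for every integer $n\ge v$, $$\mathrm{wsat}(n,F)=\mathrm{wsat}(v,F)+(n-v)(\delta-1).$$
   Context: All graphs are finite and simple. Given a graph $F$, an $F$-bootstrap percolation process is a sequence of graphs $H_0\subset H_1\subset\cdots\subset H_m$ on the same vertex set such that, for each $i=1,\ldots,m$, $H_i$ is obtained from $H_{i-1}$ by adding one edge that belongs to a copy of $F$ (a not necessarily induced subgraph isomorphic to $F$) in $H_i$. A graph $H$ on $[n]=\{1,\ldots,n\}$ is weakly $F$-saturated if there is an $F$-bootstrap percolation process $H=H_0\subset\cdots\subset H_m=K_n$. The number $\mathrm{wsat}(n,F)$ is the minimum number of edges of a weakly $F$-saturated graph on $[n]$. *)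

(* Defs.v *)
From HB Require Import structures.
From mathcomp Require Import all_boot all_order all_algebra.

Set Implicit Arguments.
Unset Strict Implicit.
Unset Printing Implicit Defensive.

(* A simple graph on V is its edge set, an edge being a two-element set of
   vertices. *)
Record sgraph (V : finType) := SGraph {
  edges : {set {set V}};
  edgesP : [forall e in edges, #|e| == 2] }.

HB.instance Definition _ (V : finType) := [isSub for @edges V].
HB.instance Definition _ (V : finType) := [Countable of sgraph V by <:].
HB.instance Definition _ (V : finType) := [Finite of sgraph V by <:].

Lemma complete_subproof (V : finType) :
  [forall e in [set e : {set V} | #|e| == 2], #|e| == 2].
Proof. by apply/forall_inP => e; rewrite inE. Qed.

Definition complete (V : finType) : sgraph V := SGraph (complete_subproof V).

Definition degree (V : finType) (G : sgraph V) (x : V) : nat :=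
  #|[set e in edges G | x \in e]|.

(* Every degree is at most #|V|, so the default value of the iterated minimum
   does not affect the result when V is nonempty. *)
Definition min_degree (V : finType) (G : sgraph V) : nat :=
  \big[minn/#|V|]_(x : V) degree G x.

Definition isolated (V : finType) (G : sgraph V) (x : V) : bool :=
  degree G x == 0.

Definition clique (V : finType) (G : sgraph V) (K : {set V}) : bool :=
  [forall x in K, forall y in K, (x != y) ==> ([set x; y] \in edges G)].

Definition union_of_cliques (V : finType) (G : sgraph V) (k : nat) : Prop :=
  forall e, e \in edges G ->
  exists K : {set V}, [/\ clique G K, e \subset K & k <= #|K|].

Definition image_edges (W V : finType) (F : sgraph W) (f : W -> V) :
  {set {set V}} := [set f @: e | e : {set W} in edges F].

(* The edge e of H lies in a copy of F in H; a copy is the image of F under an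
   injection of its vertices that maps edges to edges. *)
Definition in_copy (W V : finType) (F : sgraph W) (H : sgraph V) (e : {set V}) :
  bool :=
  [exists f : {ffun W -> V}, [&& injectiveb f,
     image_edges F f \subset edges H & e \in image_edges F f]].

Definition bootstrap_step (W V : finType) (F : sgraph W) : rel (sgraph V) :=
  fun H H' => [exists e : {set V}, [&& e \notin edges H,
     edges H' == e |: edges H & in_copy F H' e]].

(* [connect] is the existence of a finite path, possibly of length 0, of
   bootstrap steps. *)
Definition weakly_saturated (W V : finType) (F : sgraph W) (H : sgraph V) :
  bool := connect (@bootstrap_step W V F) H (complete V).

(* The minimum is over a nonempty set: the complete graph is always weakly
   saturated. *)
Definition wsat (n : nat) (W : finType) (F : sgraph W) : nat :=
  #|edges [arg min_(H < complete 'I_n | weakly_saturated F H) #|edges H|]|.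

Lemma wsatP (n : nat) (W : finType) (F : sgraph W) :
  (exists2 H : sgraph 'I_n, weakly_saturated F H & #|edges H| = wsat n F) /\
  (forall H : sgraph 'I_n, weakly_saturated F H -> wsat n F <= #|edges H|).
Proof.
rewrite /wsat; case: arg_minnP => [|H wH minH]; first exact: connect0.
by split=> //; exists H.
Qed.

(* Main.v *)
Require Import Defs.
From HB Require Import structures.
From mathcomp Require Import all_boot all_order all_algebra.
From mathcomp Require Import zify.
Import Order.TTheory GRing.Theory Num.Theory.
Set Implicit Arguments.
Unset Strict Implicit.
Unset Printing Implicit Defensive.
Local Open Scope ring_scope.

(** Let d be the minimum degree of F minus 1, and v its number of vertices.

    Lower bound: attach to each vertex i of K_n a polynomial p_i of degree less
    than d and say that the edge ij is balanced if p_i(j) = p_j(i).  By Lagrange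
    interpolation, if all edges but one of a K_{d+2} are balanced, so is the
    last; as every edge of F lies in a K_{d+2}, balancedness spreads from a
    weakly saturated graph H to K_n.  If moreover p_i = 0 for all i in a set S
    with at least d elements, then each p_j has at least d roots, so p = 0.
    Thus the balancedness of the edges of H not inside S is an injective linear
    system in d(n - |S|) unknowns, and H has at least d(n - |S|) such edges.
    Taking for S the vertices of the first copy of F to appear adds the
    #|edges F| - 1 edges inside S.

    Upper bound: a new vertex joined to d vertices of a K_m with m >= v can play
    the role of a vertex of minimum degree of F, which yields all the other
    edges at that vertex. *)

(** * Linear algebra: interpolation and systems with fewer equations than unknowns *)

(** The coefficients are the values at [x] of the Lagrange basis polynomials on [A]. They do not
    depend on [p], so one choice serves all the polynomials p_i at once. *)
Lemma interpolation_combination (K : fieldType) (I : finType) (t : I -> K)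
    (A : {set I}) (x : K) : injective t ->
  exists c : I -> K, forall p : {poly K}, (size p <= #|A|)%N ->
    p.[x] = \sum_(i in A) c i * p.[t i].
Proof.
move=> t_inj.
pose L i := \prod_(j in A :\ i) ((t i - t j)^-1 *: ('X - (t j)%:P)).
have LE i y : (L i).[y] = \prod_(j in A :\ i) ((t i - t j)^-1 * (y - t j)).
  by rewrite horner_prod; apply: eq_bigr => j _; rewrite !hornerE.
exists (fun i => (L i).[x]) => p szp.
pose q := p - \sum_(i in A) p.[t i] *: L i.
suff q0 : q = 0.
  have : q.[x] = 0 by rewrite q0 horner0.
  rewrite /q hornerD hornerN horner_sum => /eqP; rewrite subr_eq0 => /eqP ->.
  by apply: eq_bigr => i _; rewrite hornerZ mulrC.
apply: (@roots_geq_poly_eq0 _ _ [seq t i | i <- enum A]).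
- apply/allP => _ /mapP [k + ->]; rewrite mem_enum => kA.
  rewrite /root /q hornerD hornerN horner_sum (bigD1 k) //= big1 => [|i].
    rewrite addr0 hornerZ LE big1 ?mulr1 ?subrr // => j.
    rewrite !inE => /andP [jk _]; rewrite mulVf // subr_eq0.
    by apply: contra jk => /eqP /t_inj ->.
  move=> /andP [iA ik]; rewrite hornerZ LE (bigD1 k) ?inE ?(eq_sym k) ?ik //=.
  by rewrite subrr mulr0 mul0r mulr0.
- by rewrite map_inj_uniq ?enum_uniq.
rewrite size_map -cardE /q (leq_trans (size_polyD _ _)) // geq_max szp size_polyN.
apply: (big_ind (fun p : {poly K} => size p <= #|A|)%N).
- by rewrite size_poly0.
- by move=> a b ha hb; rewrite (leq_trans (size_polyD _ _)) // geq_max ha.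
move=> i iA; rewrite (leq_trans (size_scale_leq _ _)) //.
rewrite (leq_trans (size_poly_prod_leq _ _)) // [#|A|](cardsD1 i) iA add1n.
set s := (\sum_(_ in _) _)%N.
(* With k = [#|A|], a product of k - 1 linear factors has size at most 2(k - 1) + 1 - (k - 1) =
   k. *)
have sle : (s <= #|A :\ i| * 2)%N.
  rewrite -sum_nat_const; apply: leq_sum => j _.
  by rewrite (leq_trans (size_scale_leq _ _)) // size_XsubC.
move: sle; rewrite (eq_card (B := A :\ i)) => // sle; lia.
Qed.

Lemma exists_common_zero (K : fieldType) (m n : nat) (I : finType)
    (f : I -> {linear 'M[K]_(m, n) -> K^o}) : (#|I| < m * n)%N ->
  exists2 P : 'M[K]_(m, n), P != 0 & forall i, f i P = 0.
Proof.
move=> ltI.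
pose phi (u : 'rV[K]_(m * n)) : 'rV[K]_#|I| := \row_k f (enum_val k) (vec_mx u).
have phiL : linear phi.
  by move=> a u v; apply/rowP => k; rewrite !mxE !linearP.
pose phi' : {linear _ -> _} := HB.pack phi (GRing.isLinear.Build _ _ _ _ _ phiL).
have : kermx (lin1_mx phi') != 0.
  rewrite -mxrank_eq0 mxrank_ker -lt0n subn_gt0.
  exact: leq_ltn_trans (rank_leq_col _) ltI.
case/rowV0Pn => u /sub_kermxP; rewrite mul_rV_lin1 => phiu u0.
exists (vec_mx u) => [|i].
  by apply: contra u0 => /eqP u0; rewrite -[u]vec_mxK u0 linear0.
by have := congr1 (fun v : 'rV_ _ => v 0 (enum_rank i)) phiu; rewrite !mxE enum_rankK.
Qed.

(** * Balanced edges as linear equations *)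

(** Row i of [P] lists the coefficients of p_i, so the families of polynomials of degree less than d
    form a space of dimension n * d. *)
Definition row_poly (n d : nat) (P : 'M[rat]_(n, d)) (i : 'I_n) : {poly rat} :=
  rVpoly (row i P).

(* For e = {i, j} this is (j - i) * (p_i(j) - p_j(i)); the factor j - i makes the
   expression independent of an orientation of e. *)
Definition swap_defect (n d : nat) (e : {set 'I_n}) (P : 'M[rat]_(n, d)) : rat :=
  \sum_(i in e) \sum_(j in e) (j%:R - i%:R) * (row_poly P i).[j%:R].

Lemma swap_defect_linear (n d : nat) (e : {set 'I_n}) :
  linear (swap_defect e : 'M[rat]_(n, d) -> rat^o).
Proof.
move=> a P Q; rewrite /swap_defect scaler_sumr -big_split; apply: eq_bigr => i _ /=.
rewrite scaler_sumr -big_split; apply: eq_bigr => j _ /=.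
rewrite /row_poly !linearP /= !hornerE mulrDr; congr (_ + _).
by rewrite mulrCA.
Qed.

HB.instance Definition _ (n d : nat) (e : {set 'I_n}) :=
  GRing.isLinear.Build _ 'M[rat]_(n, d) rat^o _ _ (@swap_defect_linear n d e).

(** The diagonal terms of the double sum vanish, and the common factor j - i is nonzero because the
    rationals have characteristic 0. *)
Lemma swap_defect_eq0 (n d : nat) (P : 'M[rat]_(n, d)) (i j : 'I_n) : i != j ->
  (swap_defect [set i; j] P == 0) =
  ((row_poly P i).[j%:R] == (row_poly P j).[i%:R]).
Proof.
move=> ij; have ji : j \notin [set i] by rewrite inE eq_sym.
have ij' : i \notin [set j] by rewrite inE.
rewrite /swap_defect !(big_setU1 _ ij') !big_set1 /=.
rewrite !(big_setU1 _ ij') !big_set1 /= !subrr !mul0r add0r addr0.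
rewrite -[X in _ + X * _]opprB mulNr -mulrBr mulf_eq0 !subr_eq0 eqr_nat.
by rewrite eq_sym (negPf (_ : i != j :> nat)).
Qed.

Lemma size_row_poly (n d : nat) (P : 'M[rat]_(n, d)) (i : 'I_n) :
  (size (row_poly P i) <= d)%N.
Proof. exact: size_poly. Qed.

(* Interpolating p_a and p_b at the points of A writes both sides as the same
   double sum of the values p_i(j) with i, j in A, up to exchanging i and j. *)
Lemma swap_symmetric_propagation (n d : nat) (P : 'M[rat]_(n, d))
    (A : {set 'I_n}) (a b : 'I_n) : (d <= #|A|)%N ->
  (forall i j, i \in a |: A -> j \in A ->
     (row_poly P i).[j%:R] = (row_poly P j).[i%:R]) ->
  (forall j, j \in A -> (row_poly P b).[j%:R] = (row_poly P j).[b%:R]) ->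
  (row_poly P a).[b%:R] = (row_poly P b).[a%:R].
Proof.
move=> dA sym symb.
have t_inj : injective (fun i : 'I_n => i%:R : rat).
  by move=> i j /eqP; rewrite eqr_nat => /eqP /val_inj.
have [ca caE] := interpolation_combination A a%:R t_inj.
have [cb cbE] := interpolation_combination A b%:R t_inj.
have sz i : (size (row_poly P i) <= #|A|)%N := leq_trans (size_row_poly P i) dA.
transitivity (\sum_(i in A) \sum_(j in A) cb i * (ca j * (row_poly P i).[j%:R])).
  rewrite cbE //; apply: eq_bigr => i iA.
  by rewrite sym ?inE ?eqxx // caE // mulr_sumr.
rewrite caE // exchange_big; apply: eq_bigr => j jA.
rewrite symb // cbE // mulr_sumr; apply: eq_bigr => i iA.
by rewrite mulrCA sym // inE iA orbT.
Qed.

(** * Balancedness along a percolation process *)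

Lemma connect_invariant (T : finType) (r : rel T) (Q : T -> Prop) (x y : T) :
  (forall u w, r u w -> Q u -> Q w) -> connect r x y -> Q x -> Q y.
Proof.
move=> rQ /connectP [p + ->]; elim: p x => [|z p IHp] x //= /andP [xz pz] Qx.
by apply: IHp pz _; apply: rQ xz Qx.
Qed.

Lemma edge_pair (V : finType) (G : sgraph V) (e : {set V}) : e \in edges G ->
  exists x y, x != y /\ e = [set x; y].
Proof.
move=> eG; have /forall_inP/(_ _ eG)/cards2P [x [y [xy ->]]] := edgesP G.
by exists x, y.
Qed.

Lemma cliqueP (V : finType) (G : sgraph V) (K : {set V}) :
  reflect (forall x y, x \in K -> y \in K -> x != y -> [set x; y] \in edges G)
    (clique G K).
Proof.
apply: (iffP forall_inP) => [cK x y xK yK xy|cK x xK].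
  by have /forall_inP/(_ y yK)/implyP/(_ xy) := cK x xK.
by apply/forall_inP => y yK; apply/implyP; apply: cK.
Qed.

Lemma in_copy_clique (W V : finType) (F : sgraph W) (H : sgraph V) (k : nat)
    (e : {set V}) : union_of_cliques F k -> in_copy F H e ->
  exists K : {set V}, [/\ clique H K, e \subset K & (k <= #|K|)%N].
Proof.
move=> Fk /existsP [f /and3P [/injectiveP f_inj fF /imsetP [e' e'F ->]]].
have [K [cK e'K kK]] := Fk _ e'F.
exists (f @: K); split; last by rewrite card_imset.
  apply/cliqueP => _ _ /imsetP [x xK ->] /imsetP [y yK ->] xy.
  apply: (subsetP fF); apply/imsetP; exists [set x; y]; last by rewrite imsetU !imset_set1.
  by apply: (cliqueP _ _ cK) => //; apply: contra xy => /eqP ->.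
exact: imsetS.
Qed.

(** The new edge [e] lies in a clique [K] of [H'] with at least d + 2 vertices, all of whose other
    edges are already balanced. Removing both ends of [e] from [K] leaves at least d interpolation
    points. *)
Lemma swap_defect_step (W : finType) (F : sgraph W) (n d : nat)
    (H H' : sgraph 'I_n) (P : 'M[rat]_(n, d)) :
  union_of_cliques F d.+2 -> bootstrap_step F H H' ->
  {in edges H, forall e, swap_defect e P = 0} ->
  {in edges H', forall e, swap_defect e P = 0}.
Proof.
move=> Fd /existsP [e /and3P [_ /eqP H'E eF]] H0 e'; rewrite H'E !inE.
case/predU1P => [->|]; last exact: H0.
have [K [cK eK dK]] := in_copy_clique Fd eF.
have [a [b [ab eE]]] : exists a b, a != b /\ e = [set a; b].
  by apply: (@edge_pair _ H'); rewrite H'E setU11.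
have {eK} [aK bK] : a \in K /\ b \in K.
  by move: eK; rewrite eE subUset !sub1set => /andP.
have sym i j : i \in K -> j \in K -> [set i; j] != e ->
    (row_poly P i).[j%:R] = (row_poly P j).[i%:R].
  move=> iK jK ne; have [->//|ij] := eqVneq i j.
  apply/eqP; rewrite -swap_defect_eq0 // H0 //.
  by have := cliqueP _ _ cK _ _ iK jK ij; rewrite H'E !inE (negPf ne).
have off i j : j \in K :\: e -> [set i; j] != e.
  rewrite inE => /andP [je _]; apply: contra je => /eqP <-.
  by rewrite !inE eqxx orbT.
rewrite eE; apply/eqP; rewrite swap_defect_eq0 //; apply/eqP.
apply: (@swap_symmetric_propagation _ _ _ (K :\: e)).
- have ce : #|e| = 2%N by rewrite eE cards2 ab.
  have := subset_leq_card (subsetIr K e); rewrite cardsD; lia.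
- move=> i j; rewrite in_setU1 => iKe jKe.
  have jK : j \in K by move: jKe; rewrite inE => /andP [].
  apply: sym => //; last exact: off.
  by case/predU1P: iKe => [->//|]; rewrite inE => /andP [].
move=> j jKe; have jK : j \in K by move: jKe; rewrite inE => /andP [].
by apply: sym => //; exact: off.
Qed.

Lemma weakly_saturated_outer_edges (W : finType) (F : sgraph W) (n d : nat)
    (H : sgraph 'I_n) (S : {set 'I_n}) :
  union_of_cliques F d.+2 -> weakly_saturated F H -> (d <= #|S|)%N ->
  ((n - #|S|) * d <= #|[set e in edges H | ~~ (e \subset S)]|)%N.
Proof.
move=> Fd wH dS; set E := [set e in _ | _]; rewrite leqNgt; apply/negP => ltE.
(* One equation for each edge of [H] not inside [S], and d equations p_i = 0 for each i in [S]:
   fewer than n * d in all by [ltE]. *)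
pose I := ({e | e \in E} + ({i | i \in S} * 'I_d))%type.
pose coordinate (i : 'I_n) (k : 'I_d) (P : 'M[rat]_(n, d)) : rat^o := P i k.
have coordL i k : linear (coordinate i k).
  by move=> a u v; rewrite /coordinate !mxE.
pose f (x : I) : {linear 'M[rat]_(n, d) -> rat^o} :=
  match x with
  | inl e => swap_defect (val e)
  | inr ik => HB.pack (coordinate (val ik.1) ik.2)
                (GRing.isLinear.Build _ _ _ _ _ (coordL (val ik.1) ik.2))
  end.
have ltI : (#|{: I}| < n * d)%N.
  rewrite card_sum card_prod !card_sig card_ord.
  rewrite (eq_card (B := E)) // (eq_card (A := [pred x | x \in S]) (B := S)) //.
  have := max_card S; rewrite card_ord mulnBl in ltE * => Sn; nia.
have [P P0 fP] := exists_common_zero f ltI.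
have S0 i : i \in S -> row_poly P i = 0.
  move=> iS; rewrite /row_poly; have -> : row i P = 0; last by rewrite linear0.
  by apply/rowP => k; rewrite !mxE; exact: (fP (inr (exist _ i iS, k))).
have H0 : {in edges H, forall e, swap_defect e P = 0}.
  (* Edges inside [S] cost no equation: both of their polynomials are zero. *)
  move=> e eH; have [eS|eS] := boolP (e \subset S).
    rewrite /swap_defect big1 // => i ie; rewrite big1 // => j je.
    by rewrite S0 ?horner0 ?mulr0 // (subsetP eS).
  have eE : e \in E by rewrite inE eH.
  exact: (fP (inl (exist _ e eE))).
have K0 : {in edges (complete 'I_n), forall e, swap_defect e P = 0}.
  apply: (connect_invariant (Q := fun G => {in edges G, forall e, _})) wH H0.
  by move=> G G'; apply: swap_defect_step Fd.
case/eqP: P0; apply/row_matrixP => i; rewrite row0 -[row i P]rVpolyK.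
suff -> : rVpoly (row i P) = 0 by rewrite linear0.
have [/S0 //|iS] := boolP (i \in S).
(* For j in [S], balancedness of ij gives p_i(j) = p_j(i) = 0, so p_i has at least d roots. *)
apply: (@roots_geq_poly_eq0 _ _ [seq (j : 'I_n)%:R | j <- enum S]).
- apply/allP => _ /mapP [j + ->]; rewrite mem_enum => jS.
  have ij : i != j by apply: contraNneq iS => ->.
  have := swap_defect_eq0 P ij; rewrite K0 ?inE ?cards2 ?ij // eqxx.
  by rewrite (S0 j) // horner0 => /esym.
- rewrite map_inj_uniq ?enum_uniq // => j k /eqP.
  by rewrite eqr_nat => /eqP /val_inj.
by rewrite size_map -cardE (leq_trans (size_row_poly P i)).
Qed.

Local Close Scope ring_scope.

(** * Constructing percolation processes *)

Lemma card_edge (V : finType) (G : sgraph V) (e : {set V}) :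
  e \in edges G -> #|e| = 2.
Proof. by move=> eG; have /forall_inP/(_ _ eG)/eqP := edgesP G. Qed.

Lemma add_edge_subproof (V : finType) (G : sgraph V) (e : {set V}) :
  #|e| = 2 -> [forall e' in e |: edges G, #|e'| == 2].
Proof.
move=> ce; apply/forall_inP => e'; rewrite !inE => /predU1P [->|/card_edge ->//].
exact/eqP.
Qed.

Definition add_edge (V : finType) (G : sgraph V) (e : {set V}) (ce : #|e| = 2) :
  sgraph V := SGraph (add_edge_subproof G ce).

Lemma in_copy_map (W U V : finType) (F : sgraph W) (H : sgraph U) (G : sgraph V)
    (h : U -> V) (e : {set U}) : injective h ->
  image_edges H h \subset edges G -> in_copy F H e -> in_copy F G (h @: e).
Proof.
move=> h_inj HG /existsP [f /and3P [/injectiveP f_inj fF /imsetP [e' e'F ->]]].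
have hf (a : {set W}) : [ffun x => h (f x)] @: a = h @: (f @: a).
  by rewrite -imset_comp; apply: eq_imset => x; rewrite ffunE.
apply/existsP; exists [ffun x => h (f x)]; apply/and3P; split.
- by apply/injectiveP => x y; rewrite !ffunE => /h_inj /f_inj.
- apply/subsetP => _ /imsetP [a aF ->]; rewrite hf.
  by apply: (subsetP HG); apply: imset_f; apply: (subsetP fF); apply: imset_f.
by apply/imsetP; exists e'.
Qed.

(** The process from [H] is replayed in [G] along [h]. A step whose edge is already present is
    skipped, so the final graph contains the image of [H'] but may be larger. *)
Lemma percolation_map (W U V : finType) (F : sgraph W) (H H' : sgraph U)
    (G : sgraph V) (h : U -> V) : injective h ->
  connect (@bootstrap_step W U F) H H' -> image_edges H h \subset edges G ->
  exists G' : sgraph V, [/\ connect (@bootstrap_step W V F) G G',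
    edges G \subset edges G' & image_edges H' h \subset edges G'].
Proof.
move=> h_inj HH' HG.
apply: (connect_invariant (Q := fun K : sgraph U => exists G' : sgraph V,
  [/\ connect (@bootstrap_step W V F) G G', edges G \subset edges G' &
      image_edges K h \subset edges G'])) HH' _; last first.
  by exists G; split=> //; exact: connect0.
move=> K K' /existsP [e /and3P [eK /eqP K'E eF]] [G1 [GG1 sGG1 KG1]].
have ce : #|h @: e| = 2 by rewrite card_imset // (@card_edge _ K') // K'E setU11.
have sub : image_edges K' h \subset h @: e |: edges G1.
  apply/subsetP => _ /imsetP [a + ->]; rewrite K'E !inE => /predU1P [->|aK].
    by rewrite eqxx.
  by rewrite (subsetP KG1) ?orbT //; apply: imset_f.
have [eG1|eG1] := boolP (h @: e \in edges G1).
  exists G1; split=> //; apply: subset_trans sub _.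
  by rewrite subUset sub1set eG1 subxx.
exists (add_edge G1 ce); split=> //=; last exact: subset_trans (subsetUr _ _).
apply: connect_trans GG1 (connect1 _); apply/existsP; exists (h @: e).
by rewrite eG1 eqxx; apply: in_copy_map eF.
Qed.

(** The missing edges can be added in any order. Quantifying over all [G'] above [G] lets the
    hypothesis pass to [G] with an edge added, whence an induction on the size of the complement. *)
Lemma percolation_complete (W V : finType) (F : sgraph W) (G : sgraph V) :
  (forall (G' : sgraph V) (e : {set V}), edges G \subset edges G' ->
     #|e| = 2 -> e \notin edges G ->
     e \in edges G' -> in_copy F G' e) -> weakly_saturated F G.
Proof.
have [k] := ubnP #|~: edges G|; elim: k G => // k IHk G; rewrite ltnS => leGk copyF.
have [full|/forall_inPn [e /eqP ce eG]] :=
    boolP [forall (e : {set V} | #|e| == 2), e \in edges G].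
  rewrite /weakly_saturated (_ : G = complete V) ?connect0 //.
  apply: val_inj; apply/setP => e; rewrite /= inE; apply/idP/idP => [/card_edge ->//|ce].
  exact: (forall_inP full).
have step : bootstrap_step F G (add_edge G ce).
  apply/existsP; exists e; rewrite eG eqxx /=.
  by apply: copyF; rewrite //= ?subsetUr ?setU11.
apply: connect_trans (connect1 step) (IHk _ _ _) => [|G' e' /= sG' ce' e'G].
  apply: leq_trans leGk; apply: proper_card; rewrite properC properE subsetUr /=.
  by rewrite subUset sub1set negb_and eG.
apply: copyF => //; first exact: subset_trans (subsetUr _ _) sG'.
by apply: contra e'G => e'G; rewrite inE e'G orbT.
Qed.

(** * Neighbourhoods and minimum degree *)

Definition neighbours (V : finType) (G : sgraph V) (x : V) : {set V} :=
  [set y | [set x; y] \in edges G].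

Lemma notin_neighbours (V : finType) (G : sgraph V) (x : V) :
  x \notin neighbours G x.
Proof. by rewrite inE; apply/negP => /card_edge; rewrite setUid cards1. Qed.

Lemma card_neighbours (V : finType) (G : sgraph V) (x : V) :
  #|neighbours G x| <= degree G x.
Proof.
have inj : {in neighbours G x &, injective (fun y => [set x; y])}.
  move=> y z yN zN /setP /(_ y); rewrite !inE eqxx orbT.
  case: eqP => [yx|_ /esym/eqP //].
  by move: yN; rewrite yx (negPf (notin_neighbours _ _)).
rewrite -(card_in_imset inj); apply: subset_leq_card; apply/subsetP.
by move=> _ /imsetP [y + ->]; rewrite !inE eqxx => ->.
Qed.

Lemma min_degree_attained (V : finType) (G : sgraph V) : 0 < #|V| ->
  exists x, #|neighbours G x| <= min_degree G.
Proof.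
case/card_gt0P => x0 _; rewrite /min_degree.
apply: (big_ind (fun k => exists x, #|neighbours G x| <= k)).
(* The default value [#|V|] of the minimum bounds every neighbourhood. *)
- by exists x0; apply: max_card.
- by move=> a b [x hx] [y hy]; case: (leqP a b) => _; [exists x | exists y].
by move=> x _; exists x; apply: card_neighbours.
Qed.

Lemma min_degree_gt0 (V : finType) (G : sgraph V) : 0 < #|V| ->
  (forall x, ~~ isolated G x) -> 0 < min_degree G.
Proof.
move=> V0 iso; rewrite /min_degree; apply: (big_ind (fun k => 0 < k)) => // [a b a0 b0|x _].
  by rewrite leq_min a0.
by rewrite lt0n; apply: iso.
Qed.

Lemma min_degree_le_card (V : finType) (G : sgraph V) : min_degree G <= #|V|.
Proof.
rewrite /min_degree; apply: (big_rec (fun k => k <= #|V|)) => // x k _.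
exact: leq_trans (geq_minr _ _).
Qed.

Lemma neighbours_nonempty (V : finType) (G : sgraph V) (x : V) :
  ~~ isolated G x -> exists y, y \in neighbours G x.
Proof.
rewrite /isolated /degree -lt0n => /card_gt0P [e]; rewrite inE => /andP [eG].
have [a [b [ab eE]]] := edge_pair eG; rewrite eE !inE => /orP [] /eqP ->.
  by exists b; rewrite inE -eE.
by exists a; rewrite inE setUC -eE.
Qed.

(** * Injections with prescribed values *)

Lemma transfer_enumeration (V U : finType) (s : seq V) (t : seq U) (u0 : U) :
  uniq s -> uniq t -> size s <= size t -> (forall x, x \in s) ->
  exists f : {ffun V -> U}, injective f /\
    forall x, f x = nth u0 t (index x s).
Proof.
move=> us ut st sV; exists [ffun x => nth u0 t (index x s)].
split=> [x y|x]; last by rewrite ffunE.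
have lt z : index z s < size t by apply: leq_trans st; rewrite index_mem.
rewrite !ffunE => /eqP; rewrite nth_uniq // => /eqP xy.
by rewrite -(nth_index x (sV x)) xy nth_index.
Qed.

(** This places a copy of F with [x] at a new vertex [z], a neighbour [y] of [x] at [u], and the
    neighbourhood [A] of [x] inside [u |: D]. List V as x, y, the rest of A, the remainder, and U as
    z, u, D, the remainder, then match positions. *)
Lemma injection_with_neighbours (V U : finType) (x y : V) (z u : U) (A : {set V})
    (D : {set U}) : #|V| <= #|U| -> x \notin A -> y \in A -> u != z ->
    z \notin D -> u \notin D -> #|A| <= #|D|.+1 ->
  exists f : {ffun V -> U}, [/\ injective f, f x = z, f y = u &
    {in A, forall w, f w \in u |: D}].
Proof.
move=> VU xA yA uz zD uD AD.
pose s1 := y :: enum (A :\ y); pose t1 := u :: enum D.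
pose s := x :: s1 ++ enum (~: (x |: A)).
pose t := z :: t1 ++ enum (~: (z |: (u |: D))).
have s1A w : (w \in s1) = (w \in A).
  by rewrite inE mem_enum !inE; case: eqP => [->|] //=.
have t1D w : (w \in t1) = (w \in u |: D) by rewrite !inE mem_enum.
have us : uniq s.
  rewrite cons_uniq mem_cat s1A mem_enum !inE eqxx (negPf xA) cat_uniq.
  rewrite cons_uniq mem_enum !inE eqxx !enum_uniq /= andbT.
  by apply/hasPn => w; rewrite s1A mem_enum !inE negb_or => /andP [].
have ut : uniq t.
  rewrite cons_uniq mem_cat t1D mem_enum !inE eqxx (negPf zD) eq_sym (negPf uz).
  rewrite cat_uniq cons_uniq mem_enum uD !enum_uniq /= andbT.
  by apply/hasPn => w; rewrite t1D mem_enum inE in_setU1 negb_or => /andP [].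
have sV w : w \in s.
  rewrite inE mem_cat s1A mem_enum !inE; by case: eqP; case: (w \in A).
have tU w : w \in t.
  rewrite inE mem_cat t1D mem_enum !inE.
  by case: eqP; case: eqP; case: (w \in D).
have sizes (T : finType) (r : seq T) : uniq r -> (forall w, w \in r) -> size r = #|T|.
  by move=> ur rT; rewrite cardE; apply/perm_size/uniq_perm; rewrite ?enum_uniq // => w;
     rewrite rT mem_enum.
have [||f [f_inj fE]] := transfer_enumeration z us ut.
- by rewrite !sizes.
- exact: sV.
have xy : x != y by apply: contraNneq xA => ->.
exists f; split=> //; rewrite ?fE /= ?eqxx ?(negPf xy) //= ?eqxx //.
move=> w wA; have xw : x != w by apply: contraNneq xA => ->.
rewrite fE -t1D.
have -> : index w s = (index w (s1 ++ enum (~: (x |: A)))).+1.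
  by rewrite [LHS]/= (negPf xw).
rewrite -[nth _ _ _]/(nth z (t1 ++ _) _) index_cat s1A wA nth_cat.
(* The block of [A] is no longer than that of [u |: D], since [#|A| <= #|D|.+1]. *)
have lt : index w s1 < size t1.
  have : index w s1 < size s1 by rewrite index_mem s1A.
  move/leq_trans; apply; rewrite /= -!cardE; move: AD; rewrite (cardsD1 y A) yA.
  by rewrite add1n.
by rewrite lt mem_nth.
Qed.

Lemma image_edges_complete (U V : finType) (h : U -> V) (G : sgraph V)
    (a b : U) : image_edges (complete U) h \subset edges G -> a != b ->
  [set h a; h b] \in edges G.
Proof.
move=> hG ab; apply: (subsetP hG); apply/imsetP; exists [set a; b].
  by rewrite inE cards2 ab.
by rewrite imsetU !imset_set1.
Qed.

(** * Upper bound *)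

(** An optimal graph on m vertices is extended by a vertex [z] joined to a set [D] of d old
    vertices. The old vertices first percolate to a complete graph; then each missing edge zu
    completes a copy of F with a vertex of minimum degree at [z]. *)
Lemma wsat_succ (W : finType) (F : sgraph W) (m : nat) :
  0 < #|W| -> (forall x, ~~ isolated F x) -> #|W| <= m ->
  wsat m.+1 F <= wsat m F + (min_degree F).-1.
Proof.
move=> W0 iso Wm.
have [[H wH HE] _] := wsatP m F; have [_ wmin] := wsatP m.+1 F.
set d := (min_degree F).-1.
have d0 : 0 < min_degree F := min_degree_gt0 W0 iso.
have dm : d <= m by have := min_degree_le_card F; lia.
pose z : 'I_m.+1 := ord_max; pose h : 'I_m -> 'I_m.+1 := lift z.
have h_inj : injective h := @lift_inj _ z.
have hz i : h i != z by rewrite eq_sym neq_lift.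
pose D := [set h (widen_ord dm i) | i : 'I_d].
have cD : #|D| = d.
  by rewrite card_imset ?card_ord // => i j /h_inj /(congr1 val) /= /val_inj.
have zD : z \notin D by apply/imsetP => [[i _]] /eqP; rewrite eq_sym (negPf (hz _)).
pose E := image_edges H h :|: [set [set z; u] | u in D].
have E2 : [forall e in E, #|e| == 2].
  apply/forall_inP => e; rewrite inE => /orP [] /imsetP [a aP ->].
    by rewrite card_imset // (card_edge aP).
  by rewrite cards2 (_ : z != a) //; apply: contraNneq zD => ->.
pose G := SGraph E2.
apply: leq_trans (wmin G _) _; last first.
  rewrite /= -HE (leq_trans (leq_card_setU _ _)) // leq_add ?leq_imset_card //.
  by rewrite -cD leq_imset_card.
have [|G1 [GG1 sGG1 KG1]] := percolation_map (G := G) h_inj wH.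
  exact: subsetUl.
apply: connect_trans GG1 _; apply: percolation_complete => G' e sG' ce eG1 eG'.
have others a b : a != z -> b != z -> a != b -> [set a; b] \in edges G1.
  have zl c : c != z -> exists c', c = h c'.
    by rewrite eq_sym => /unlift_some [c' -> _]; exists c'.
  move=> /zl [a' ->] /zl [b' ->] ab.
  by apply: image_edges_complete KG1 _; apply: contra ab => /eqP ->.
have [u [uz eE]] : exists u, u != z /\ e = [set z; u].
  have [a [b [ab eE]]] := edge_pair eG'.
  have [az|az] := eqVneq a z; first by exists b; rewrite eq_sym -az.
  have [bz|bz] := eqVneq b z; first by exists a; rewrite az setUC -bz.
  by rewrite eE others in eG1.
have DG1 w : w \in D -> [set z; w] \in edges G1.
  by move=> wD; apply: (subsetP sGG1); rewrite inE; apply/orP; right; apply: imset_f.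
have uD : u \notin D by apply: contra eG1; rewrite eE; apply: DG1.
have [x xF] := min_degree_attained F W0.
have [y yx] := neighbours_nonempty (iso x).
have [|//|//|//|//|//||f [f_inj fx fy fN]] :=
    @injection_with_neighbours _ _ x y z u (neighbours F x) D.
- by rewrite card_ord ltnW.
- exact: notin_neighbours.
(* The neighbourhood of [x] has at most d + 1 vertices: one goes to [u], the others into [D]. *)
- by rewrite cD prednK.
apply/existsP; exists f; apply/and3P; split; first exact/injectiveP.
  (* Edges of F at [x] go to zu or to edges from [z] to [D]; all others land in the complete graph
     on the old vertices. *)
  have key a : [set x; a] \in edges F -> f @: [set x; a] \in edges G'.
    rewrite imsetU !imset_set1 fx => xa.
    have: f a \in u |: D by apply: fN; rewrite inE.
    by case/setU1P => [->|/DG1 /(subsetP sG') //]; rewrite -eE.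
  apply/subsetP => _ /imsetP [e' e'F ->].
  have [a [b [ab e'E]]] := edge_pair e'F; rewrite e'E in e'F *.
  have [ax|ax] := eqVneq a x; first by rewrite ax in e'F *; apply: key.
  have [bx|bx] := eqVneq b x; first by rewrite bx setUC in e'F *; apply: key.
  rewrite imsetU !imset_set1 (subsetP sG') //.
  by apply: others; rewrite -?fx (inj_eq f_inj).
by apply/imsetP; exists [set x; y]; [rewrite inE in yx | rewrite imsetU !imset_set1 fx fy].
Qed.

Lemma wsat_upper (W : finType) (F : sgraph W) (n : nat) :
  0 < #|W| -> (forall x, ~~ isolated F x) -> #|W| <= n ->
  wsat n F <= wsat #|W| F + (n - #|W|) * (min_degree F).-1.
Proof.
move=> W0 iso /subnKC <-; rewrite addKn.
elim: (n - #|W|) => [|k IHk]; first by rewrite addn0 mul0n addn0.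
rewrite addnS (leq_trans (wsat_succ W0 iso _)) ?leq_addr //.
by rewrite mulSnr addnA leq_add2r.
Qed.

(** * Lower bound *)

Lemma wsat_lower (W : finType) (F : sgraph W) (n d : nat) :
  union_of_cliques F d.+2 -> d <= #|W| -> #|W| <= n ->
  #|edges F|.-1 + (n - #|W|) * d <= wsat n F.
Proof.
move=> Fd dW Wn; have [[H wH <-] _] := wsatP n F.
suff [S cS HS] : exists2 S : {set 'I_n}, #|S| = #|W| &
    #|edges F|.-1 <= #|[set e in edges H | e \subset S]|.
  have := @weakly_saturated_outer_edges _ _ _ _ _ S Fd wH; rewrite cS => /(_ dW) out.
  rewrite -(cardsID [set e : {set 'I_n} | e \subset S] (edges H)) leq_add //.
    by apply: leq_trans HS _; rewrite setIdE.
  apply: leq_trans out _; apply: subset_leq_card; apply/subsetP => e.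
  by rewrite !inE andbC.
(* If all edges of a copy of F except possibly [e] lie in [H], its vertex set serves as [S]. *)
have inner (f : W -> 'I_n) (e : {set 'I_n}) : injective f ->
    image_edges F f \subset e |: edges H ->
    exists2 S : {set 'I_n}, #|S| = #|W| &
      #|edges F|.-1 <= #|[set e' in edges H | e' \subset S]|.
  move=> f_inj fF; exists (f @: [set: W]); first by rewrite card_imset // cardsT.
  have <- : #|image_edges F f| = #|edges F| by rewrite card_imset //; apply: imset_inj.
  apply: (@leq_trans #|image_edges F f :\ e|).
    by rewrite (cardsD1 e (image_edges F f)); case: (e \in _); rewrite ?leq_pred.
  apply: subset_leq_card; apply/subsetP => e'; rewrite !inE => /andP [e'e e'F].
  move: (subsetP fF _ e'F); rewrite !inE (negPf e'e) /= => ->.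
  by case/imsetP: e'F => a _ ->; rewrite imsetS ?subsetT.
case/connectP: wH => [[|H' p] /=].
  (* The process is empty, so [H] is complete and any injection gives a copy; [set0] stands in for
     the absent added edge. *)
  move=> _ HE; pose f (x : W) := widen_ord Wn (enum_rank x).
  have f_inj : injective f by move=> x y /(congr1 val) /= /val_inj /enum_rank_inj.
  apply: (inner f set0) => //; apply/subsetP => _ /imsetP [a aF ->].
  by rewrite -HE !inE card_imset // (card_edge aF) orbT.
case/andP => /existsP [e /and3P [_ /eqP H'E /existsP [f /and3P [/injectiveP f_inj fF _]]]].
by move=> _ _; apply: (inner f e) => //; rewrite -H'E.
Qed.

Local Open Scope ring_scope.

Theorem mainTheorem11 (V : finType) (F : sgraph V)
    (F_edge : (0 < #|edges F|)%N)
    (F_no_isolated : forall x : V, ~~ isolated F x)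
    (F_cliques : union_of_cliques F (min_degree F + 1)%N) :
  (exists C N : nat, forall n : nat, (N <= n)%N ->
     `| (wsat n F)%:Z - ((min_degree F)%:Z - 1) * n%:Z | <= C%:Z) /\
  ((wsat #|V| F)%:Z = #|edges F|%:Z - 1 ->
   forall n : nat, (#|V| <= n)%N ->
     (wsat n F)%:Z = (wsat #|V| F)%:Z
       + (n%:Z - #|V|%:Z) * ((min_degree F)%:Z - 1)).
Proof.
have V0 : (0 < #|V|)%N.
  have /card_gt0P [e /edge_pair [x _]] := F_edge.
  by apply/card_gt0P; exists x.
have d0 := min_degree_gt0 V0 F_no_isolated.
have dV := min_degree_le_card F.
have upper n := @wsat_upper _ F n V0 F_no_isolated.
have Fd : union_of_cliques F (min_degree F).-1.+2 by rewrite prednK // -addn1.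
have lower n := @wsat_lower _ F n _ Fd (leq_trans (leq_pred _) dV).
split.
  (* The first summand absorbs the excess of the upper bound over dn, the second the deficit vd of
     the lower bound. *)
  exists (wsat #|V| F + #|V| * (min_degree F).-1)%N, #|V| => n Vn.
  move: (upper n Vn) (lower n Vn); nia.
(* By [tight] the constant terms of the two bounds agree; [F_edge] makes the truncated predecessor
   of the number of edges a true difference. *)
by move=> tight n Vn; move: (upper n Vn) (lower n Vn); nia.
Qed.
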